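(* Let $\pi$ be a stationary deterministic policy of a finite Markov decision process with state space $\mathcal S$, and suppose that the induced transition matrix $P_\pi$ is irreducible, with unique stationary distribution $\mu$. Let $\gamma\in[0,1)$, let $r\in\mathbb R^{|\mathcal S|}$ be a reward vector with non-negative entries, not identically zero, and let $v_\pi$ be the value function of $\pi$ with discount factor $\gamma$ and reward vector $r$. Define $$\langle r\rangle_\mu:=\sum_{x\in\mathcal S} r(x)\mu(x),\qquad u(s):=\frac{r(s)\mu(s)}{\langle r\rangle_\mu}\quad(s\in\mathcal S).$$ Let $w$ be the PageRank vector associated with the time-reversed transition matrix $P_\pi^*$, teleportation parameter $\gamma$ and restart distribution $u$. Then $$v_\pi(s)=\frac{\langle r\rangle_\mu}{1-\gamma}\,\frac{w(s)}{\mu(s)}\qquad\text{for all } s\in\mathcal S.$$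
   Context: A finite Markov decision process has a finite state space $\mathcal S$, a finite action space $\mathscr A$, transition probabilities $p(s'\mid s,a)$ and rewards $r(s,a)$. A stationary deterministic policy is a map $\pi:\mathcal S\to\mathscr A$; it induces the Markov chain $(X_t)_{t\ge0}$ on $\mathcal S$ with row-stochastic transition matrix $P_\pi(s,s')=p(s'\mid s,\pi(s))$ and the reward vector $r(s)=r(s,\pi(s))$. The value function with discount factor $\gamma\in[0,1)$ is $v_\pi(s)=\mathbb E\big[\sum_{t\ge0}\gamma^t r(X_t)\mid X_0=s\big]$; equivalently, it is the unique solution of the Bellman equation $v_\pi=r+\gamma P_\pi v_\pi$ (column vectors). The stationary distribution $\mu$ of an irreducible row-stochastic matrix $P$ is the unique probability row vector with $\mu=\mu P$; it has strictly positive entries. With $D:=\mathrm{diag}(\mu)$, the time reversal of $P$ is $P^*:=D^{-1}P^\top D$, which is row-stochastic. Given a row-stochastic matrix $M$ on $\mathcal S$, a teleportation parameter $c\in[0,1)$ and a probability vector $u$ on $\mathcal S$ (the restart distribution), the PageRank vector is the unique probability row vector $w$ with $w=c\,wM+(1-c)\,u$. *)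

(* Defs.v *)
From HB Require Import structures.
From mathcomp Require Import all_boot all_order all_algebra.
From mathcomp Require Import all_classical all_reals all_analysis.

Set Implicit Arguments.
Unset Strict Implicit.
Unset Printing Implicit Defensive.

Import Order.TTheory GRing.Theory Num.Theory.
Import numFieldNormedType.Exports.

Local Open Scope classical_set_scope.
Local Open Scope ring_scope.

(* Matrices and vectors over a finite type S are indexed by 'I_#|S|;
   enum_val and enum_rank translate between indices and states. *)

Definition prob_vector (R : realType) (n : nat) (u : 'rV[R]_n) : Prop :=
  (forall i, 0 <= u 0 i) /\ \sum_i u 0 i = 1.

Record mdp (R : realType) (S A : finType) := Mdp {
  trans : S -> A -> S -> R;
  reward : S -> A -> R;
  trans_ge0 : forall s a s', 0 <= trans s a s';
  trans_sum1 : forall s a, \sum_s' trans s a s' = 1 }.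

Definition policy_mx (R : realType) (S A : finType) (M : mdp R S A)
    (pi : S -> A) : 'M[R]_#|S| :=
  \matrix_(i, j) trans M (enum_val i) (pi (enum_val i)) (enum_val j).

Definition irreducible_mx (R : realType) (n : nat) (P : 'M[R]_n) : Prop :=
  forall i j, exists k : nat, 0 < (P ^+ k) i j.

Definition stationary_distribution (R : realType) (n : nat) (P : 'M[R]_n)
    (mu : 'rV[R]_n) : Prop :=
  prob_vector mu /\ mu = mu *m P.

Definition time_reversal (R : realType) (n : nat) (mu : 'rV[R]_n)
    (P : 'M[R]_n) : 'M[R]_n :=
  invmx (diag_mx mu) *m P^T *m diag_mx mu.

Definition pagerank_vector (R : realType) (n : nat) (M : 'M[R]_n) (c : R)
    (u w : 'rV[R]_n) : Prop :=
  prob_vector w /\ w = c *: (w *m M) + (1 - c) *: u.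

(* The law of X_0 is arbitrary.  The second clause is
   Pr(X_{n+1} = x_{n+1} | X_0 = x_0, ..., X_n = x_n) = P(x_n, x_{n+1}),
   multiplied out so that histories of probability zero need no exception. *)
Definition markov_chain (R : realType) (S : finType) (P : 'M[R]_#|S|)
    (d : measure_display) (Omega : measurableType d)
    (Pr : probability Omega R) (X : nat -> Omega -> S) : Prop :=
  (forall t s, measurable (X t @^-1` [set s])) /\
  (forall (n : nat) (x : nat -> S),
     Pr [set omega | forall t, (t <= n.+1)%N -> X t omega = x t] =
     (Pr [set omega | forall t, (t <= n)%N -> X t omega = x t] *
      (P (enum_rank (x n)) (enum_rank (x n.+1)))%:E)%E).

Definition cond_expectation (R : realType)
    (d : measure_display) (Omega : measurableType d)
    (Pr : probability Omega R) (Z : Omega -> R) (B : set Omega) : R :=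
  (\int[Pr]_(omega in B) Z omega) / fine (Pr B).

Definition discounted_return (R : realType) (S : finType) (Omega : Type)
    (X : nat -> Omega -> S) (gamma : R) (r : S -> R) (omega : Omega) : R :=
  limn (series (fun t => gamma ^+ t * r (X t omega))).

(* Meaningful at the states s with Pr(X_0 = s) > 0. *)
Definition value_function (R : realType) (S : finType)
    (d : measure_display) (Omega : measurableType d)
    (Pr : probability Omega R) (X : nat -> Omega -> S)
    (gamma : R) (r : S -> R) (s : S) : R :=
  cond_expectation Pr (discounted_return X gamma r) (X 0%N @^-1` [set s]).

Definition mean_reward (R : realType) (S : finType) (mu : 'rV[R]_#|S|)
    (r : S -> R) : R :=
  \sum_(x : S) r x * mu 0 (enum_rank x).

Definition restart_distribution (R : realType) (S : finType)
    (mu : 'rV[R]_#|S|) (r : S -> R) : 'rV[R]_#|S| :=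
  \row_i (r (enum_val i) * mu 0 i / mean_reward mu r).

(* Main.v *)
Require Import Defs.
From mathcomp Require Import all_boot all_order all_algebra.
From mathcomp Require Import all_classical all_reals all_analysis.
From mathcomp Require Import measurable_realfun ring.
Import Order.TTheory GRing.Theory Num.Theory.
Import numFieldNormedType.Exports.
Local Open Scope classical_set_scope.
Local Open Scope ring_scope.

(** Multiplying a row vector on the right by the time reversal D^-1 P^T D and
then dividing its entries by mu is the same as dividing by mu first and then
applying P to the resulting column vector ([time_reversal_mulmx]).  Hence the
PageRank equation for w turns into an equation for h = w / mu, namely
  h = gamma P h + ((1 - gamma) / <r>) r,
because the restart distribution divided by mu is r / <r>.  After rescaling
by <r> / (1 - gamma) this is the Bellman equation v = r + gamma P v
([pagerank_bellman]).  The divisions make sense since mu is positive, by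
irreducibility ([stationary_gt0]).

It remains to see that any solution v of the Bellman equation is the
conditional expectation of the discounted return
([value_function_bellman]).  Write q_t(x) for Pr(X_0 = s, X_t = x).  The
Markov property gives q_(t+1) = q_t P as row vectors ([joint_law_step]), so
the Bellman equation yields <q_t, r> = <q_t, v> - gamma <q_(t+1), v>.
Weighted by gamma^t these identities telescope ([joint_law_telescope]), the
remainder gamma^n <q_n, v> tends to 0 because q_n is bounded, and monotone
convergence identifies the sum of the series with the integral of the
discounted return over the event X_0 = s.  Only <q_0, v> = v(s) Pr(X_0 = s)
survives. *)

Set Implicit Arguments.
Unset Strict Implicit.
Unset Printing Implicit Defensive.

(** * Positivity of the stationary distribution *)

Lemma nonneg_mx_exp (R : realType) (n : nat) (P : 'M[R]_n) (k : nat) :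
  (forall i j, 0 <= P i j) -> forall i j, 0 <= (P ^+ k) i j.
Proof.
move=> P_ge0; elim: k => [|k IHk] i j.
  by rewrite expr0 mxE; case: eqP.
rewrite exprS mxE; apply: sumr_ge0 => l _.
by rewrite mulr_ge0.
Qed.

Lemma stationary_exp (R : realType) (n : nat) (P : 'M[R]_n) (mu : 'rV[R]_n)
    (k : nat) : mu = mu *m P -> mu = mu *m P ^+ k.
Proof.
move=> muP; elim: k => [|k IHk]; first by rewrite expr0 mulmx1.
by rewrite exprS mulmxA -muP.
Qed.

(** Some state i has positive mass; irreducibility gives k such that i reaches
j in k steps with positive probability, and mu = mu P^k moves mass from i to
j. *)
Lemma stationary_gt0 (R : realType) (n : nat) (P : 'M[R]_n) (mu : 'rV[R]_n) :
  (forall i j, 0 <= P i j) -> irreducible_mx P ->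
  stationary_distribution P mu -> forall j, 0 < mu 0 j.
Proof.
move=> P_ge0 Pirr [[mu_ge0 mu_sum1] muP] j.
have [i mui_gt0] : exists i, 0 < mu 0 i.
  apply/not_existsP => mu_le0; move: mu_sum1.
  rewrite big1 => [/esym/eqP|i _]; first by rewrite oner_eq0.
  apply/eqP; rewrite eq_le mu_ge0 andbT leNgt.
  exact/negP/mu_le0.
have [k Pk_gt0] := Pirr i j.
rewrite (@stationary_exp _ _ _ _ k muP) mxE (bigD1 i) //=.
rewrite ltr_wpDr ?mulr_gt0 //; apply: sumr_ge0 => l _.
by rewrite mulr_ge0 ?nonneg_mx_exp.
Qed.

(** * From PageRank of the time reversal to the Bellman equation *)

(** The time reversal is the adjoint of P for the inner product weighted by mu:
acting on row vectors w by the reversal amounts to acting on the column vectors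
w / mu by P. *)
Lemma time_reversal_mulmx (R : realType) (n : nat) (mu w : 'rV[R]_n)
    (P : 'M[R]_n) (i : 'I_n) : (forall j, 0 < mu 0 j) ->
  (w *m time_reversal mu P) 0 i = (\sum_j P i j * (w 0 j / mu 0 j)) * mu 0 i.
Proof.
move=> mu_gt0.
have Du : diag_mx mu \in unitmx.
  rewrite unitmxE det_diag unitfE; apply/prodf_neq0 => j _.
  by rewrite gt_eqF.
have wD : w *m invmx (diag_mx mu) = \row_j (w 0 j / mu 0 j).
  apply: (can_inj (mulmxK Du)); rewrite mulmxKV // mul_mx_diag.
  by apply/rowP => j; rewrite !mxE divfK // gt_eqF.
rewrite /time_reversal !mulmxA wD mul_mx_diag !mxE.
by congr (_ * _); apply: eq_bigr => j _; rewrite !mxE mulrC.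
Qed.

(** The PageRank equation at one state, divided by mu, is the Bellman equation up
to the factor <r> / (1 - gamma); that factor turns the restart term
(1 - gamma) r(s) / <r> into the reward r(s). *)
Lemma pagerank_bellman (R : realType) (S : finType) (P : 'M[R]_#|S|)
    (mu w : 'rV[R]_#|S|) (gamma : R) (r : S -> R) (s : S) :
  (forall j, 0 < mu 0 j) -> gamma < 1 -> 0 < mean_reward mu r ->
  pagerank_vector (time_reversal mu P) gamma (restart_distribution mu r) w ->
  let v x := mean_reward mu r / (1 - gamma) *
             (w 0 (enum_rank x) / mu 0 (enum_rank x)) in
  v s = r s + gamma * \sum_y P (enum_rank s) (enum_rank y) * v y.
Proof.
move=> mu_gt0 gamma_lt1 mr_gt0 [_ /rowP/(_ (enum_rank s)) w_eq] v.
set mr := mean_reward mu r in mr_gt0 w_eq v *.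
have sumE : \sum_y P (enum_rank s) (enum_rank y) * v y =
    mr / (1 - gamma) * \sum_j P (enum_rank s) j * (w 0 j / mu 0 j).
  (* Matrix indices run over ordinals, v over states. *)
  rewrite mulr_sumr (reindex_onto enum_rank enum_val) /=; last first.
    by move=> i _; rewrite enum_valK.
  by apply: eq_big => [y|y _]; rewrite ?enum_rankK ?eqxx // mulrCA.
rewrite mxE [X in X + _]mxE [X in _ + X]mxE [X in (1 - _) * X]mxE in w_eq.
rewrite time_reversal_mulmx // enum_rankK -/mr in w_eq.
rewrite sumE {1}/v w_eq.
have muN0 : mu 0 (enum_rank s) != 0 by rewrite gt_eqF.
have gN0 : 1 - gamma != 0 by rewrite subr_eq0 gt_eqF.
have mrN0 : mr != 0 by rewrite gt_eqF.
set T := \sum_j _.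
by rewrite /T -/mr; field; rewrite muN0 mrN0 gN0.
Qed.

(** * Functions of a finite-valued map *)

Lemma comp_finE (R : realType) (S : finType) (Omega : Type)
    (Y : Omega -> S) (g : S -> R) :
  g \o Y = (fun omega => \sum_x g x * \1_(Y @^-1` [set x]) omega).
Proof.
apply/funext => omega /=; rewrite (bigD1 (Y omega)) //= big1 ?addr0.
  by rewrite indicE mem_set // mulr1.
move=> x xY; rewrite indicE memNset ?mulr0 //= => Yx.
by rewrite Yx eqxx in xY.
Qed.

Lemma measurable_comp_fin (R : realType) (S : finType) (d : measure_display)
    (Omega : measurableType d) (B : set Omega) (Y : Omega -> S) (g : S -> R) :
  (forall x, measurable (Y @^-1` [set x])) -> measurable_fun B (g \o Y).
Proof.
move=> mY; rewrite comp_finE; apply: measurable_sum => x.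
by apply: measurable_funM => //; exact: measurable_funTS.
Qed.

Lemma integral_comp_fin (R : realType) (S : finType) (d : measure_display)
    (Omega : measurableType d) (m : {measure set Omega -> \bar R})
    (B : set Omega) (Y : Omega -> S) (g : S -> R) :
  measurable B -> (forall x, measurable (Y @^-1` [set x])) ->
  (forall x, 0 <= g x) ->
  (\int[m]_(omega in B) (g (Y omega))%:E =
   \sum_(x : S) (g x)%:E * m (B `&` Y @^-1` [set x]))%E.
Proof.
move=> mB mY g_ge0.
have mf x : measurable_fun B (\1_(Y @^-1` [set x]) : Omega -> R).
  exact: measurable_funTS.
under eq_integral => omega _ do
  rewrite -[g (Y omega)]/((g \o Y) omega) comp_finE -sumEFin.
rewrite ge0_integral_sum //=; last 2 first.
- move=> x; apply/measurable_EFinP.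
  exact: measurable_funM.
- by move=> x omega _; rewrite lee_fin mulr_ge0.
apply: eq_bigr => x _; under eq_integral do rewrite EFinM.
rewrite ge0_integralZl_EFin //; last exact/measurable_EFinP.
by rewrite integral_indic // setIC.
Qed.

(** The case g = 1 of [integral_comp_fin]: total probability over the fibers of
Y. *)
Lemma measure_fibers (R : realType) (S : finType) (d : measure_display)
    (Omega : measurableType d) (m : {measure set Omega -> \bar R})
    (B : set Omega) (Y : Omega -> S) :
  measurable B -> (forall x, measurable (Y @^-1` [set x])) ->
  (m B = \sum_(x : S) m (B `&` Y @^-1` [set x]))%E.
Proof.
move=> mB mY.
have := integral_comp_fin m mB mY (fun=> ler01).
rewrite integral_cst // mul1e => ->.
by under eq_bigr do rewrite mul1e.
Qed.

(** * The Markov property *)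

Section MarkovChain.
Context {R : realType} {S : finType} {P : 'M[R]_#|S|} {d : measure_display}
  {Omega : measurableType d} {Pr : probability Omega R}
  {X : nat -> Omega -> S}.
Hypothesis X_chain : markov_chain P Pr X.

Local Notation p x y := (P (enum_rank x) (enum_rank y)).
Local Notation start s := (X 0%N @^-1` [set s]).

Let mX t s : measurable (X t @^-1` [set s]). Proof. exact: X_chain.1. Qed.

(** The coordinates strictly between 0 and k are left free, and X_0 = s is kept
throughout.  For k = 0 this is an initial path segment, as in the definition
of a Markov chain; for k = n only the initial and the current state remain. *)
Definition history (s : S) (k n : nat) (x : nat -> S) : set Omega :=
  start s `&` [set omega | forall t, (k <= t <= n)%N -> X t omega = x t].

Lemma measurable_history s k n x : measurable (history s k n x).
Proof.
apply: measurableI => //.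
rewrite (_ : [set _ | _] =
    \bigcap_(t in [set t | (k <= t <= n)%N]) X t @^-1` [set x t]) //.
by apply: bigcap_measurableType => t _; exact: mX.
Qed.

Lemma history_fiber s k n x y : (k <= n)%N ->
  history s k.+1 n x `&` X k @^-1` [set y] =
  history s k n (fun t => if t == k then y else x t).
Proof.
move=> kn; apply/seteqP; split=> omega /=.
  move=> [[Xs Xx] Xy]; split=> // t /andP[kt tn].
  case: eqP => [->//|/eqP tk]; apply: Xx.
  by rewrite ltn_neqAle eq_sym tk kt.
move=> [Xs Xx]; split; last by rewrite Xx ?leqnn ?kn // eqxx.
split=> // t /andP[kt tn].
by rewrite Xx ?(ltnW kt) ?tn // gtn_eqF.
Qed.

(** Induction on k, from the full path down to the current state: the transition
factor depends only on x n and x n.+1, so it survives summation over the values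
of X_k as long as k < n. *)
Lemma history_step s k n x : (k <= n)%N ->
  (Pr (history s k n.+1 x) =
   Pr (history s k n x) * (p (x n) (x n.+1))%:E)%E.
Proof.
elim: k x => [|k IHk] x kn.
  (* A path starting elsewhere than at s makes both sides zero. *)
  have hE m : history s 0 m x = if x 0%N == s then
      [set omega | forall t, (t <= m)%N -> X t omega = x t] else set0.
    case: eqP => [xs|xs]; apply/seteqP; split=> omega //=.
    - by move=> [].
    - by move=> Xx; split=> [|t /Xx//]; rewrite -xs; exact: Xx.
    - by move=> [Xs Xx]; apply: xs; rewrite -Xs; apply/esym/Xx.
  rewrite !hE; case: ifP => _; last by rewrite !measure0 mul0e.
  exact: X_chain.2.
have fibers m : (k < m)%N -> (Pr (history s k.+1 m x) =
    \sum_y Pr (history s k m (fun t => if t == k then y else x t)))%E.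
  move=> km; rewrite (measure_fibers _ _ (mX k)) //.
    by apply: eq_bigr => y _; rewrite history_fiber // ltnW.
  exact: measurable_history.
rewrite !fibers ?leqW // ge0_sume_distrl //; apply: eq_bigr => y _.
by rewrite IHk ?(ltnW kn) // !gtn_eqF // leqW.
Qed.

Definition joint_law (s : S) (t : nat) (x : S) : R :=
  fine (Pr (start s `&` X t @^-1` [set x])).

Lemma joint_lawE s t x :
  ((joint_law s t x)%:E = Pr (start s `&` X t @^-1` [set x]))%E.
Proof.
by rewrite /joint_law fineK // fin_num_measure //; exact: measurableI.
Qed.

Lemma joint_law_ge0 s t x : 0 <= joint_law s t x.
Proof. by rewrite /joint_law fine_ge0. Qed.

Lemma joint_law_le1 s t x : joint_law s t x <= 1.
Proof.
by rewrite -lee_fin joint_lawE probability_le1 //; exact: measurableI.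
Qed.

Lemma joint_law0 s x : joint_law s 0 x = (fine (Pr (start s))) *+ (x == s).
Proof.
rewrite /joint_law; case: eqP => [->|xs]; first by rewrite setIid.
rewrite (_ : _ `&` _ = set0) ?measure0 //.
by apply/seteqP; split=> // omega /= [-> /esym].
Qed.

Lemma joint_law_step s t y :
  joint_law s t.+1 y = \sum_x joint_law s t x * p x y.
Proof.
apply/eqP; rewrite -eqe -sumEFin joint_lawE; apply/eqP.
rewrite (measure_fibers _ _ (mX t)); last exact: measurableI.
apply: eq_bigr => x _.
rewrite EFinM joint_lawE.
pose z u := if u == t then x else y.
have -> : start s `&` X t.+1 @^-1` [set y] `&` X t @^-1` [set x] =
          history s t t.+1 z.
  rewrite /history /z; apply/seteqP; split=> omega /=.
    move=> [[Xs Xy] Xx]; split=> // u /andP[tu ut].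
    case: eqP => [->//|/eqP ut'].
    have -> // : u = t.+1.
    by apply/eqP; rewrite eqn_leq ut ltn_neqAle eq_sym ut'.
  move=> [Xs Xx]; have := Xx t; have := Xx t.+1.
  rewrite !leqnn leqnSn eqxx gtn_eqF // => Xy Xt.
  by split; [split=> //; exact: Xy | exact: Xt].
have -> : start s `&` X t @^-1` [set x] = history s t t z.
  rewrite /history /z; apply/seteqP; split=> omega /= [Xs Xx]; split=> //.
    by move=> u; rewrite -eqn_leq => /eqP <-; rewrite eqxx.
  by rewrite Xx ?leqnn // eqxx.
by apply: etrans (history_step s z (leqnn t)) _; rewrite /z eqxx gtn_eqF.
Qed.

Lemma integral_joint_law s t (g : S -> R) : (forall x, 0 <= g x) ->
  (\int[Pr]_(omega in start s) (g (X t omega))%:E =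
   (\sum_x g x * joint_law s t x)%:E)%E.
Proof.
move=> g_ge0; rewrite (integral_comp_fin _ _ (mX t)) // -sumEFin.
by apply: eq_bigr => x _; rewrite EFinM joint_lawE.
Qed.

(** * Solutions of the Bellman equation are value functions *)

Section Bellman.
Context {gamma : R} {r v : S -> R}.
Hypotheses (gamma_ge0 : 0 <= gamma) (gamma_lt1 : gamma < 1).
Hypothesis r_ge0 : forall s, 0 <= r s.

(** On a finite state space r is bounded, by the sum of its values, so the series
is dominated by a geometric one. *)
Lemma discounted_return_cvg omega :
  cvgn (series (fun t => gamma ^+ t * r (X t omega))).
Proof.
have term_ge0 t : 0 <= gamma ^+ t * r (X t omega) by rewrite mulr_ge0 ?exprn_ge0.
pose b := \sum_x r x.
have b_ge0 : 0 <= b by apply: sumr_ge0.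
apply: (@series_le_cvg _ _ (geometric b gamma)) => [//|t|t|] /=.
- by rewrite mulr_ge0 ?exprn_ge0.
- rewrite mulrC ler_wpM2r ?exprn_ge0 //.
  by rewrite /b (bigD1 (X t omega)) //= lerDl sumr_ge0.
- by apply: is_cvg_geometric_series; rewrite ger0_norm.
Qed.

Lemma discounted_returnE omega :
  ((discounted_return X gamma r omega)%:E =
   \sum_(0 <= t <oo) (gamma ^+ t * r (X t omega))%:E)%E.
Proof.
rewrite -EFin_lim; last exact: discounted_return_cvg.
by congr (limn _); apply/funext => n /=; rewrite sumEFin.
Qed.

Hypothesis bellman : forall s, v s = r s + gamma * \sum_y p s y * v y.

(** Substituting the Bellman equation for v in the remainder produces the next
term of the sum plus the next remainder, since joint_law s n.+1 is
joint_law s n times P. *)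
Lemma joint_law_telescope s n :
  \sum_(0 <= t < n) gamma ^+ t * \sum_x r x * joint_law s t x =
  v s * fine (Pr (start s)) - gamma ^+ n * \sum_x v x * joint_law s n x.
Proof.
elim: n => [|n IHn].
  rewrite big_geq // mul1r (bigD1 s) //= big1 => [|x /negPf xs]; last first.
    by rewrite joint_law0 xs mulr0.
  by rewrite joint_law0 eqxx addr0 subrr.
rewrite big_nat_recr //= IHn -addrA; congr (_ + _).
apply/eqP; rewrite eq_sym -subr_eq0 opprD !opprK exprSr -mulrA.
have -> : \sum_x v x * joint_law s n.+1 x =
          \sum_x (\sum_y p x y * v y) * joint_law s n x.
  under eq_bigr do rewrite joint_law_step mulr_sumr.
  rewrite exchange_big; apply: eq_bigr => x _; rewrite mulr_suml.
  by apply: eq_bigr => y _; ring.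
have -> : \sum_x v x * joint_law s n x = \sum_x r x * joint_law s n x +
    gamma * \sum_x (\sum_y p x y * v y) * joint_law s n x.
  rewrite mulr_sumr -big_split; apply: eq_bigr => x _ /=.
  by rewrite bellman mulrDl mulrA.
by apply/eqP; rewrite mulrDr; ring.
Qed.

Lemma joint_law_cvg s :
  series (fun t => gamma ^+ t * \sum_x r x * joint_law s t x) @ \oo -->
  v s * fine (Pr (start s)).
Proof.
rewrite (_ : series _ = fun n => v s * fine (Pr (start s)) -
    gamma ^+ n * \sum_x v x * joint_law s n x); last first.
  by apply/funext => n; exact: joint_law_telescope.
rewrite -[in X in _ --> X](subr0 (v s * _)).
apply: cvgB; first exact: cvg_cst.
(* As a probability, joint_law is at most 1, so the last sum is bounded by
   sum_x |v x|, uniformly in n. *)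
apply/norm_cvg0P.
apply: (@squeeze_cvgr _ _ _ _ (cst 0) (geometric (\sum_x `|v x|) gamma)).
- near=> n => /=; rewrite normr_ge0 normrM normrX ger0_norm // mulrC.
  rewrite ler_wpM2r ?exprn_ge0 //.
  apply: (le_trans (ler_norm_sum _ _ _)); apply: ler_sum => x _.
  rewrite normrM (ger0_norm (joint_law_ge0 _ _ _)).
  by rewrite ler_piMr ?joint_law_le1.
- exact: cvg_cst.
- by apply: cvg_geometric; rewrite ger0_norm.
Unshelve. all: by end_near. Qed.

(** Nonnegativity of r allows the exchange of sum and integral by monotone
convergence, and [joint_law_cvg] evaluates the resulting series. *)
Lemma integral_discounted_return s :
  \int[Pr]_(omega in start s) discounted_return X gamma r omega =
  v s * fine (Pr (start s)).
Proof.
rewrite /Rintegral; under eq_integral do rewrite discounted_returnE.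
rewrite integral_nneseries //; last 2 first.
- move=> t; apply/measurable_EFinP; apply: measurable_funM => //.
  exact: (@measurable_comp_fin _ _ _ _ _ (X t) r).
- by move=> t omega _; rewrite lee_fin mulr_ge0 ?exprn_ge0.
have termE t : (\int[Pr]_(omega in start s) (gamma ^+ t * r (X t omega))%:E =
    (gamma ^+ t * \sum_x r x * joint_law s t x)%:E)%E.
  rewrite (@integral_joint_law s t (fun x => gamma ^+ t * r x)); last first.
    by move=> x; rewrite mulr_ge0 ?exprn_ge0.
  by rewrite mulr_sumr; under eq_bigr do rewrite -mulrA.
under eq_eseriesr => t _ do rewrite termE.
rewrite (_ : limn _ = (v s * fine (Pr (start s)))%:E) //.
apply: cvg_lim => //; under eq_fun do rewrite sumEFin.
by apply: cvg_EFin; [exact: nearW | exact: joint_law_cvg].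
Qed.

Lemma value_function_bellman s : (0 < Pr (start s))%E ->
  value_function Pr X gamma r s = v s.
Proof.
move=> start_gt0; rewrite /value_function /cond_expectation.
rewrite integral_discounted_return mulfK // gt_eqF // fine_gt0 //.
by rewrite start_gt0 ltey_eq fin_num_measure.
Qed.

End Bellman.
End MarkovChain.

Theorem theorem1 (R : realType) (S A : finType) (M : mdp R S A) (pi : S -> A)
  (mu w : 'rV[R]_#|S|) (gamma : R) (r : S -> R)
  (d : measure_display) (Omega : measurableType d)
  (Pr : probability Omega R) (X : nat -> Omega -> S)
  (Pirr : irreducible_mx (policy_mx M pi))
  (mu_stat : stationary_distribution (policy_mx M pi) mu)
  (gamma_ge0 : 0 <= gamma) (gamma_lt1 : gamma < 1)
  (r_ge0 : forall s, 0 <= r s) (r_neq0 : exists s, r s != 0)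
  (X_chain : markov_chain (policy_mx M pi) Pr X)
  (w_pagerank : pagerank_vector (time_reversal mu (policy_mx M pi)) gamma
                  (restart_distribution mu r) w) :
  forall s : S, (0 < Pr (X 0%N @^-1` [set s]))%E ->
    value_function Pr X gamma r s =
    mean_reward mu r / (1 - gamma) * (w 0 (enum_rank s) / mu 0 (enum_rank s)).
Proof.
move=> s start_gt0.
have mu_gt0 : forall j, 0 < mu 0 j.
  by apply: stationary_gt0 mu_stat => // i j; rewrite mxE trans_ge0.
have mr_gt0 : 0 < mean_reward mu r.
  have [x rx] := r_neq0.
  rewrite /mean_reward (bigD1 x) //= ltr_wpDr //.
    by apply: sumr_ge0 => y _; rewrite mulr_ge0 // ltW.
  by rewrite mulr_gt0 // lt_neqAle eq_sym rx r_ge0.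
pose v x := mean_reward mu r / (1 - gamma) *
            (w 0 (enum_rank x) / mu 0 (enum_rank x)).
apply: (value_function_bellman X_chain gamma_ge0 gamma_lt1 r_ge0 (v := v)) => //.
by move=> x; exact: pagerank_bellman.
Qed.
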